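(* In a graph $G$ with no more than $n(n-1)/2$ edges, each edge is contained, on the average, in no more than $n-2$ triangles; that is, $$\frac{1}{|E(G)|}\sum_{e\in E(G)} t(e)\le n-2.$$ Equality holds only for the complete graph $K_n$.
   Context: Graphs are finite, simple, loopless and undirected; $n$ is a positive integer. $E(G)$ is the edge set of $G$ (nonempty, so that the average makes sense), and $t(e)$ is the number of triangles of $G$ containing the edge $e$. A triangle of $G$ is a set of three pairwise adjacent vertices; it contains an edge $e$ if both endpoints of $e$ belong to it. $K_n$ is the complete graph on $n$ vertices.
   Formalization: Equality is characterized up to isolated vertices: it holds exactly when G with its isolated vertices deleted is isomorphic to K_n (K_n plus an isolated vertex also attains equality, so the literal claim fails). *)

(* Defs.v *)
From HB Require Import structures.
From mathcomp Require Import all_boot all_order all_algebra.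

Set Implicit Arguments.
Unset Strict Implicit.
Unset Printing Implicit Defensive.

Record sgraph := SGraph {
  vertex :> finType;
  adj : rel vertex;
  adj_sym : symmetric adj;
  adj_irrefl : irreflexive adj
}.

(* Edges are unordered: two-element sets of vertices. *)
Definition edges (G : sgraph) : {set {set G}} :=
  [set e : {set G} | [exists x : G, exists y : G, adj x y && (e == [set x; y])]].

Definition triangles (G : sgraph) : {set {set G}} :=
  [set A : {set G} | (#|A| == 3) &&
    [forall x in A, forall y in A, (x != y) ==> adj x y]].

Definition triangles_at (G : sgraph) (e : {set G}) : nat :=
  #|[set A in triangles G | e \subset A]|.

Lemma complete_sym n : symmetric (fun i j : 'I_n => i != j).
Proof. by move=> i j; rewrite eq_sym. Qed.

Lemma complete_irrefl n : irreflexive (fun i j : 'I_n => i != j).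
Proof. by move=> i; rewrite eqxx. Qed.

Definition complete_graph (n : nat) : sgraph :=
  SGraph (@complete_sym n) (@complete_irrefl n).

Definition graph_iso (G H : sgraph) : Prop :=
  exists2 f : G -> H, bijective f & forall x y : G, adj (f x) (f y) = adj x y.

Definition induced_adj (G : sgraph) (S : {set G}) (u v : {x : G | x \in S}) :
  bool := adj (val u) (val v).

Lemma induced_sym (G : sgraph) (S : {set G}) : symmetric (@induced_adj G S).
Proof. by move=> u v; exact: adj_sym. Qed.

Lemma induced_irrefl (G : sgraph) (S : {set G}) :
  irreflexive (@induced_adj G S).
Proof. by move=> u; exact: adj_irrefl. Qed.

Definition induced (G : sgraph) (S : {set G}) : sgraph :=
  SGraph (@induced_sym G S) (@induced_irrefl G S).

(* Isolated vertices lie on no edge and in no triangle, so adding them to a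
   graph changes neither the number of edges nor the number of triangles; a
   graph that attains equality is determined only up to isolated vertices. *)
Definition without_isolated (G : sgraph) : sgraph :=
  induced [set x : G | [exists y : G, adj x y]].

(* Main.v *)
Require Import Defs.
From HB Require Import structures.
From mathcomp Require Import all_boot all_order all_algebra.
From mathcomp Require Import zify lra.
Import Order.TTheory GRing.Theory Num.Theory.
Local Open Scope ring_scope.

(** Write [d v] for the degree of a vertex [v], [m] for the number of edges and
    [p v] for the number of ordered pairs of adjacent neighbours of [v].  Counting
    over ordered pairs of adjacent vertices doubles every sum over edges, so
      [2 m = \sum_v d v]   and   [2 \sum_e t(e) = \sum_v p v],
    and the bound follows by summation once [p v <= (n - 2) d v] is known for each
    single vertex.  Two estimates of [p v] together give this:
    - [p v <= d v (d v - 1)], the trivial bound, which suffices when [d v < n];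
    - [p v + 2 d v <= 2 m <= n (n - 1)], because the edges at [v] are disjoint from
      those inside its neighbourhood, which suffices (strictly) when [n <= d v].

    If equality holds in the sum, it holds at each vertex, and then every
    non-isolated vertex has degree exactly [n - 1].  As [2 m <= n (n - 1)], there
    are at most [n] of these; a non-isolated vertex and its [n - 1] neighbours
    already make up [n], so any two distinct non-isolated vertices are adjacent.
    Conversely, in a complete graph on [n] vertices each edge lies in exactly
    [n - 2] triangles. *)

Section Counting.
Variable G : sgraph.
Implicit Types (x y v : G) (e : {set G}).
Local Open Scope nat_scope.

Definition nbhd x : {set G} := [set y | adj x y].

Definition degree x : nat := #|nbhd x|.

Definition codegree x y : nat := #|nbhd x :&: nbhd y|.

(** Twice the number of triangles at [v]: each edge inside the neighbourhood is
    counted from both of its ends. *)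
Definition link_size v : nat := \sum_(x in nbhd v) codegree v x.

Definition non_isolated : {set G} := [set x : G | [exists y : G, adj x y]].

Lemma adj_neq x y : adj x y -> x != y.
Proof. by apply: contraTneq => ->; rewrite adj_irrefl. Qed.

Lemma in_nbhdC x y : (x \in nbhd y) = (y \in nbhd x).
Proof. by rewrite !inE adj_sym. Qed.

Lemma set2_eq (a b x y : G) :
  ([set a; b] == [set x; y]) = ((a, b) == (x, y)) || ((a, b) == (y, x)).
Proof.
apply/eqP/idP=> [E|/orP[]/eqP[-> ->] //]; last by rewrite setUC.
have : a \in [set x; y] by rewrite -E set21.
have : b \in [set x; y] by rewrite -E set22.
have : x \in [set a; b] by rewrite E set21.
have : y \in [set a; b] by rewrite E set22.
rewrite !inE !xpair_eqE ![x == _]eq_sym ![y == _]eq_sym.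
by do 4 case: (_ == _) => //=.
Qed.

(** Double counting: an edge [{x, y}] comes from exactly the two ordered pairs
    [(x, y)] and [(y, x)]. *)
Lemma sum_ordered_edges (F : {set G} -> nat) :
  \sum_x \sum_(y in nbhd x) F [set x; y] = 2 * \sum_(e in edges G) F e.
Proof.
rewrite pair_big_dep /= big_distrr /=.
rewrite (partition_big (fun q : G * G => [set q.1; q.2]) (mem (edges G))) /=;
  last first.
  move=> [x y] /=; rewrite inE => xy.
  by rewrite inE; apply/existsP; exists x; apply/existsP; exists y; rewrite xy /=.
apply: eq_bigr => e; rewrite inE => /existsP[x /existsP[y /andP[xy /eqP ->]]].
have nxy := adj_neq _ _ xy.
rewrite (eq_bigr (fun _ => F [set x; y])) => [|q /andP[_ /eqP -> //]].
rewrite sum_nat_const; congr (_ * _).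
rewrite (@eq_card _ _ (mem [set (x, y); (y, x)])).
  by rewrite cards2 xpair_eqE (negbTE nxy).
move=> [a b]; rewrite unfold_in /= !inE set2_eq.
by apply/andb_idl => /orP[]/eqP[-> ->] //; rewrite adj_sym.
Qed.

Lemma sum_degree : \sum_x degree x = 2 * #|edges G|.
Proof.
rewrite -sum1_card -(sum_ordered_edges (fun=> 1)).
by apply: eq_bigr => x _; rewrite sum1_card.
Qed.

(** A triangle containing the edge [{x, y}] is determined by its third vertex,
    which is an arbitrary common neighbour of [x] and [y]. *)
Lemma triangles_at_edge x y :
  adj x y -> triangles_at [set x; y] = codegree x y.
Proof.
move=> xy; have nxy := adj_neq _ _ xy.
have inj : {in nbhd x :&: nbhd y &, injective (fun z => z |: [set x; y])}.
  move=> z z'; rewrite !inE => /andP[/adj_neq xz /adj_neq yz] _ E.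
  have := setU11 z [set x; y]; rewrite E !inE.
  by rewrite ![z == _]eq_sym (negbTE xz) (negbTE yz) !orbF => /eqP.
rewrite /codegree -(card_in_imset inj); apply: eq_card => A.
rewrite !inE; apply/andP/imsetP.
- case=> /andP[/eqP A3 /forall_inP cl] sub.
  have : #|A :\: [set x; y]| == 1.
    by rewrite cardsD (setIidPr sub) A3 cards2 nxy.
  case/cards1P=> z Dz; exists z; last first.
    by rewrite -Dz setUC -{1}(setIidPr sub) setUC setUC setID.
  have : z \in A :\: [set x; y] by rewrite Dz set11.
  rewrite !inE negb_or => /andP[/andP[zx zy] zA].
  have [xA yA] : x \in A /\ y \in A.
    by split; apply: (subsetP sub); rewrite !inE eqxx ?orbT.
  have /forall_inP/(_ z zA) := cl x xA; have /forall_inP/(_ z zA) := cl y yA.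
  by rewrite ![_ == z]eq_sym zx zy /= => -> ->.
- case=> z; rewrite !inE => /andP[xz yz] ->; split; last exact: subsetUr.
  have [nxz nyz] := (adj_neq _ _ xz, adj_neq _ _ yz).
  rewrite cardsU1 cards2 nxy !inE ![z == _]eq_sym negb_or nxz nyz /=.
  apply/forall_inP=> a; rewrite !inE => Ha; apply/forall_inP=> b; rewrite !inE => Hb.
  apply/implyP; move: Ha Hb.
  by do 2 ![case/orP=> [/eqP->|/orP[]/eqP->]]; rewrite ?eqxx // adj_sym.
Qed.

Lemma sum_link_size :
  \sum_v link_size v = 2 * \sum_(e in edges G) triangles_at e.
Proof.
rewrite -sum_ordered_edges; apply: eq_bigr => x _; apply: eq_bigr => y.
by rewrite inE => xy; rewrite triangles_at_edge.
Qed.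

(** A neighbour [x] of [v] is not among its own neighbours, so at most
    [degree v - 1] of the neighbours of [v] are adjacent to it. *)
Lemma link_size_le_degree v :
  link_size v + degree v <= degree v * degree v.
Proof.
rewrite -{1 2}[degree v]sum1_card /link_size -big_split /= big_distrl /=.
apply: leq_sum => x xv; rewrite mul1n addn1; apply: proper_card.
apply/properP; split; first exact: subsetIl.
by exists x => //; rewrite !inE adj_irrefl andbF.
Qed.

(** The sum of all degrees counts [degree v] at [v] itself and, at each neighbour
    [x] of [v], both [v] and the common neighbours of [v] and [x]. *)
Lemma link_size_le_edges v :
  link_size v + 2 * degree v <= 2 * #|edges G|.
Proof.
rewrite -sum_degree (bigD1 v) //= mul2n -addnn addnCA leq_add2l.
rewrite -{1}[degree v]sum1_card /link_size -big_split /=.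
rewrite [leqRHS](bigID (mem (nbhd v))) /=.
rewrite [X in _ <= X + _](eq_bigl (mem (nbhd v))); last first.
  move=> x /=; apply: andb_idl; rewrite inE => /adj_neq.
  by rewrite eq_sym.
apply: leq_trans (leq_addr _ _); apply: leq_sum => x xv.
rewrite addn1; apply: proper_card; apply/properP; split; first exact: subsetIr.
by exists v; [rewrite in_nbhdC | rewrite !inE adj_irrefl].
Qed.

Lemma degree_gt0 x : (0 < degree x) = (x \in non_isolated).
Proof.
rewrite card_gt0 inE; apply/set0Pn/existsP=> -[y];
  by [rewrite inE => ?; exists y | move=> ?; exists y; rewrite inE].
Qed.

Section Bound.
Variables (n : nat) (small : 2 * #|edges G| <= n * n.-1).

(** The local form of the theorem.  For degrees below [n] the bound by the degree
    decides, for the others the bound by the number of edges. *)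
Lemma link_size_bound v : link_size v + 2 * degree v <= n * degree v.
Proof.
have := link_size_le_degree v; have := link_size_le_edges v.
by have [] := ltnP (degree v) n; nia.
Qed.

(** From degree [n] on, the bound by the number of edges is strict; below [n],
    the bound by the degree leaves only [n - 1]. *)
Lemma link_size_bound_eq v : v \in non_isolated ->
  link_size v + 2 * degree v = n * degree v -> (degree v).+1 = n.
Proof.
rewrite -degree_gt0.
have := link_size_le_degree v; have := link_size_le_edges v.
by have [] := ltnP (degree v) n; nia.
Qed.

Lemma sum_bounds :
  (\sum_v (link_size v + 2 * degree v) =
     2 * (\sum_(e in edges G) triangles_at e + 2 * #|edges G|)) *
  (\sum_v (n * degree v) = 2 * (n * #|edges G|)).
Proof.
split; last by rewrite -big_distrr /= sum_degree mulnCA.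
by rewrite big_split -big_distrr /= sum_degree sum_link_size mulnDr.
Qed.

Lemma triangle_sum_bound :
  \sum_(e in edges G) triangles_at e + 2 * #|edges G| <= n * #|edges G|.
Proof.
rewrite -(@leq_pmul2l 2) // -!sum_bounds.
by apply: leq_sum => v _; exact: link_size_bound.
Qed.

Lemma triangle_sum_eq_degree :
  \sum_(e in edges G) triangles_at e + 2 * #|edges G| = n * #|edges G| ->
  {in non_isolated, forall v, (degree v).+1 = n}.
Proof.
move=> E v vW; apply: link_size_bound_eq vW _; apply/eqP.
have [_] := leqif_sum (fun u (_ : true) => leqif_eq (link_size_bound u)).
by rewrite !sum_bounds E eqxx => /esym/forallP/(_ v).
Qed.

(** All non-isolated vertices lie in the closed neighbourhood of any one of them:
    that neighbourhood has [n] elements, and the edge bound [2 m <= n (n - 1)]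
    leaves no room for further vertices of degree [n - 1]. *)
Lemma triangle_sum_eq_complete : edges G != set0 ->
  \sum_(e in edges G) triangles_at e + 2 * #|edges G| = n * #|edges G| ->
  #|non_isolated| = n /\ {in non_isolated &, forall x y, adj x y = (x != y)}.
Proof.
move=> nzE /triangle_sum_eq_degree deg.
have degsum : \sum_x degree x = #|non_isolated| * n.-1.
  rewrite (bigID (mem non_isolated)) /= [X in _ + X]big1 ?addn0; last first.
    by move=> x; rewrite -degree_gt0 -eqn0Ngt => /eqP.
  by rewrite -sum_nat_const; apply: eq_bigr => x /deg <-.
have m_gt0 : 0 < #|edges G| by rewrite card_gt0.
have leW : #|non_isolated| <= n by move: degsum small m_gt0; rewrite sum_degree; nia.
have closed x : x \in non_isolated -> x |: nbhd x = non_isolated.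
  move=> xW; apply/eqP; rewrite eqEcard; apply/andP; split.
    apply/subsetP=> y; rewrite !inE => /orP[/eqP ->|xy]; first by rewrite inE in xW.
    by apply/existsP; exists x; rewrite adj_sym.
  by rewrite cardsU1 inE adj_irrefl add1n (deg x xW).
split=> [|x y xW yW].
  have /card_gt0P[x xW] : 0 < #|non_isolated|.
    by move: degsum m_gt0; rewrite sum_degree; nia.
  by rewrite -(closed x xW) cardsU1 inE adj_irrefl add1n (deg x xW).
by move: yW; rewrite -(closed x xW) !inE; case: eqVneq => // ->; rewrite adj_irrefl.
Qed.
End Bound.

(** The common neighbours of the ends of an edge are the [n - 2] other
    non-isolated vertices. *)
Lemma complete_triangle_sum n : #|non_isolated| = n ->
  {in non_isolated &, forall x y, adj x y = (x != y)} ->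
  \sum_(e in edges G) triangles_at e + 2 * #|edges G| = n * #|edges G|.
Proof.
move=> Wn cW; rewrite -!sum1_card !big_distrr -big_split /=.
apply: eq_bigr => e; rewrite inE => /existsP[x /existsP[y /andP[xy /eqP ->]]].
have [xW yW] : x \in non_isolated /\ y \in non_isolated.
  by split; rewrite inE; apply/existsP; [exists y | exists x; rewrite adj_sym].
rewrite !muln1 triangles_at_edge // /codegree -Wn.
rewrite [#|non_isolated|](cardsD1 x) xW [#|non_isolated :\ x|](cardsD1 y).
rewrite in_setD1 yW eq_sym (adj_neq _ _ xy) /= addnA addnC; congr (_ + _).
apply: eq_card => z; rewrite !inE; apply/andP/and3P=> [[xz yz]|[zy zx zW]].
  rewrite ![z == _]eq_sym !adj_neq //; split=> //.
  by apply/existsP; exists x; rewrite adj_sym.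
have {}zW : z \in non_isolated by rewrite inE.
by rewrite !cW // ![_ == z]eq_sym.
Qed.
End Counting.

(** A bijection with ['I_n] transports the relation [!=], so any enumeration of the
    vertices is an isomorphism. *)
Lemma iso_completeP (H : sgraph) (n : nat) :
  graph_iso H (complete_graph n) <->
  #|H| = n /\ forall x y : H, adj x y = (x != y).
Proof.
split=> [[f bf fE]|[Hn HE]].
  split=> [|x y]; first by rewrite (bij_eq_card bf) card_ord.
  by rewrite -fE /= (inj_eq (bij_inj bf)).
exists (fun x : H => cast_ord Hn (enum_rank x)).
  exists (fun i => enum_val (cast_ord (esym Hn) i)) => x.
    by rewrite cast_ordK enum_rankK.
  by rewrite enum_valK cast_ordKV.
by move=> x y /=; rewrite (inj_eq (@cast_ord_inj _ _ Hn)) (inj_eq enum_rank_inj) HE.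
Qed.

Lemma without_isolated_completeP (G : sgraph) (n : nat) :
  graph_iso (without_isolated G) (complete_graph n) <->
  #|non_isolated G| = n /\
  {in non_isolated G &, forall x y, adj x y = (x != y)}.
Proof.
have cardW : #|without_isolated G| = #|non_isolated G|.
  by rewrite card_sig; apply: eq_card.
rewrite iso_completeP cardW; split=> -[Wn WE]; split=> //.
  by move=> x y xW yW; exact: (WE (exist _ x xW) (exist _ y yW)).
by move=> [x xW] [y yW]; exact: WE.
Qed.

Theorem theorem2 (n : nat) (G : sgraph)
  (hn : (0 < n)%N)
  (hE : edges G != set0)
  (hcard : #|edges G|%:R <= n%:R * (n%:R - 1) / 2 :> rat) :
  #|edges G|%:R^-1 * (\sum_(e in edges G) (triangles_at e)%:R) <= n%:R - 2 :> rat
  /\ (#|edges G|%:R^-1 * (\sum_(e in edges G) (triangles_at e)%:R) = n%:R - 2 :> rat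
      <-> graph_iso (without_isolated G) (complete_graph n)).
Proof.
have small : (2 * #|edges G| <= n * n.-1)%N.
  rewrite -(ler_nat rat) !natrM -subn1 natrB //.
  by move: hcard; set a := n%:R * _; lra.
have m_gt0 : 0 < #|edges G|%:R :> rat by rewrite ltr0n card_gt0.
rewrite -natr_sum mulrC; set S := (\sum_(e in _) _)%N; split.
  rewrite ler_pdivrMr // mulrBl lerBrDr -!natrM -natrD ler_nat.
  exact: triangle_sum_bound.
rewrite without_isolated_completeP.
transitivity ((S + 2 * #|edges G|)%N = (n * #|edges G|)%N).
  split=> [/(canRL (divfK (lt0r_neq0 m_gt0)))|] E.
    by apply/eqP; rewrite -(eqr_nat rat) natrD !natrM E mulrBl subrK.
  apply: (mulIf (lt0r_neq0 m_gt0)).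
  by rewrite divfK ?lt0r_neq0 // mulrBl -!natrM -E natrD addrK.
by split=> [|[]]; [exact: triangle_sum_eq_complete | exact: complete_triangle_sum].
Qed.
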